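(* Let a processing chain with size parameters $B$, $L$, $c_j$, $k_j$ and stride products $k_j^*$ be given whose application in a strided fashion is well-defined, and let $D\ge B$ be a signal length such that $k_L^*$ divides $D-B+1$. Fix $j\in\{1,\dots,L\}$. Let $S_{f_j}$ (respectively $S_{g_j}$) be the ratio of the number of evaluations of $f_j$ (respectively $g_j$) in layer $j$ required by subsignal-based application of the chain to all $D-B+1$ subsignals of length $B$ to the number required by signal-based (sliding, fragmented) application, that is $$S_{f_j}:=\frac{(D-B+1)(u_{j-1}-c_j+1)}{k_{j-1}^*\,(U_{j-1}-c_j+1)},\qquad S_{g_j}:=\frac{(D-B+1)\,u_j}{k_{j-1}^*\,k_j\,U_j}.$$ Then: (1) $S_{f_j}=1+\dfrac{(U_{j-1}-u_{j-1})(u_{j-1}-c_j)}{U_{j-1}-c_j+1}\ge1$, with equality only if $u_{j-1}=U_{j-1}$ or $u_{j-1}=c_j$; and $S_{g_j}=1+\dfrac{(U_j-u_j)(u_j-1)}{U_j}\ge1$, with equality only if $u_j=U_j$ or $u_j=1$. (2) Regarded as functions of $D$, $S_{f_j}(D+k_L^* )\ge S_{f_j}(D)$ and $S_{g_j}(D+k_L^* )\ge S_{g_j}(D)$. (3) As $D\to\infty$ through admissible lengths, $\lim S_{f_j}(D)=u_{j-1}-c_j+1$ and $\lim S_{g_j}(D)=u_j$.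
   Context: $\mathbb{N}_1=\{1,2,\dots\}$. A processing chain has a subsignal length (receptive field size) $B\in\mathbb{N}_1$, a number of layers $L\in\mathbb{N}_1$, and in layer $j\in\{1,\dots,L\}$ a function $f_j$ of $c_j\in\mathbb{N}_1$ consecutive samples, applied at every position (sliding window advanced by one sample), followed by a function $g_j$ of $k_j\in\mathbb{N}_1$ consecutive samples. Stride products: $k_j^*:=\prod_{\nu=1}^jk_\nu$, $k_0^*=1$. Subsignal-based application (strided fashion) to a signal of length $B$: in layer $j$ apply $f_j$ at every position of the current signal, then $g_j$ to consecutive non-overlapping blocks of $k_j$ samples. The signal lengths after the layers are $u_0=B$, $u_j=\frac{1}{k_j}(u_{j-1}-c_j+1)$. The strided application is well-defined if all $u_j$ obtained in this way are positive integers (so each $u_{j-1}\ge c_j$ and $k_j$ divides $u_{j-1}-c_j+1$). Layer $j$ requires $u_{j-1}-c_j+1$ evaluations of $f_j$ and $u_j$ evaluations of $g_j$ per subsignal. Signal-based application (sliding fashion) to an entire signal of length $D$: in layer $j$, for each of $k_{j-1}^*$ current fragments, each of $U_{j-1}$ samples, apply $f_j$ at every position, then $g_j$ at every position, and then split each result into $k_j$ fragments of equal length. The fragment lengths are $U_0=D$, $U_j=\frac{1}{k_j}(U_{j-1}-c_j+1-k_j+1)$, equivalently $U_j=\frac{1}{k_j^*}\big(D-k_j^*+1-\sum_{\mu=1}^jk_{\mu-1}^*(c_\mu-1)\big)$. Layer $j$ requires, per input fragment, $U_{j-1}-c_j+1$ evaluations of $f_j$ and $k_jU_j$ evaluations of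 $g_j$. A length $D\ge B$ is admissible if $k_L^*$ divides $D-B+1$; the next larger admissible length is $D+k_L^*$. *)

(* Defs.v *)
From HB Require Import structures.
From mathcomp Require Import all_boot all_order all_algebra.
From mathcomp Require Import all_classical all_reals all_analysis.

Set Implicit Arguments.
Unset Strict Implicit.
Unset Printing Implicit Defensive.

Import Order.TTheory GRing.Theory Num.Theory.
Import numFieldNormedType.Exports.

Local Open Scope ring_scope.

(* Layers are numbered 1, ..., L as in the mathematics: c j and k j are the    *)
(* window sizes of f_j and g_j, and their values at 0 or beyond L are never    *)
(* used.  All lengths are computed in R with exact division, so that their     *)
(* being positive integers is a property and not an artefact of truncation.    *)

Definition stride_prod (k : nat -> nat) (j : nat) : nat :=
  (\prod_(1 <= nu < j.+1) k nu)%N.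

(* u_j, with u_0 = B and u_j = (u_(j-1) - c_j + 1) / k_j. *)
Fixpoint strided_len (R : realType) (B : nat) (c k : nat -> nat) (j : nat) : R :=
  if j is i.+1 then
    (strided_len R B c k i - (c i.+1)%:R + 1) / (k i.+1)%:R
  else B%:R.

(* U_j, with U_0 = D and U_j = (U_(j-1) - c_j + 1 - k_j + 1) / k_j. *)
Fixpoint frag_len (R : realType) (D : nat) (c k : nat -> nat) (j : nat) : R :=
  if j is i.+1 then
    (frag_len R D c k i - (c i.+1)%:R + 1 - (k i.+1)%:R + 1) / (k i.+1)%:R
  else D%:R.

Definition strided_well_defined (R : realType) (B L : nat) (c k : nat -> nat) :
    Prop :=
  forall j : nat, (1 <= j <= L)%N ->
    strided_len R B c k j \is a Num.int /\ 0 < strided_len R B c k j.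

Definition admissible (B L : nat) (k : nat -> nat) (D : nat) : Prop :=
  (B <= D)%N /\ (stride_prod k L %| D - B + 1)%N.

(* Numbers of evaluations in layer j >= 1 of f_j and g_j: strided application  *)
(* to all D - B + 1 subsignals, versus sliding application to the entire       *)
(* signal, where layer j receives k_1 * ... * k_(j-1) fragments.               *)
Definition strided_evals_f (R : realType) (B : nat) (c k : nat -> nat)
    (j D : nat) : R :=
  (D%:R - B%:R + 1) * (strided_len R B c k j.-1 - (c j)%:R + 1).

Definition strided_evals_g (R : realType) (B : nat) (c k : nat -> nat)
    (j D : nat) : R :=
  (D%:R - B%:R + 1) * strided_len R B c k j.

Definition sliding_evals_f (R : realType) (c k : nat -> nat) (j D : nat) : R :=
  (stride_prod k j.-1)%:R * (frag_len R D c k j.-1 - (c j)%:R + 1).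

Definition sliding_evals_g (R : realType) (c k : nat -> nat) (j D : nat) : R :=
  (stride_prod k j.-1)%:R * ((k j)%:R * frag_len R D c k j).

Definition speedup_f (R : realType) (B : nat) (c k : nat -> nat) (j D : nat) : R :=
  strided_evals_f R B c k j D / sliding_evals_f R c k j D.

Definition speedup_g (R : realType) (B : nat) (c k : nat -> nat) (j D : nat) : R :=
  strided_evals_g R B c k j D / sliding_evals_g R c k j D.

(* Main.v *)
Require Import Defs.
From HB Require Import structures.
From mathcomp Require Import all_boot all_order all_algebra.
From mathcomp Require Import all_classical all_reals all_analysis.
From mathcomp Require Import ring lra.

Set Implicit Arguments.
Unset Strict Implicit.
Unset Printing Implicit Defensive.

Import Order.TTheory GRing.Theory Num.Theory.
Import numFieldNormedType.Exports.

Local Open Scope classical_set_scope.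
Local Open Scope ring_scope.

(** Write [u], [U] for the strided and sliding signal lengths and [N = D - B + 1].
    The recursions give [U_i - u_i + 1 = N / k_i^*], so after cancelling the
    stride product both speed-ups become [x a / (x + a - 1)], with
    [x = N / k_(j-1)^*], [a = u_(j-1) - c_j + 1] for [f_j] and
    [x = N / k_j^*], [a = u_j] for [g_j].  Here [x >= 1] by admissibility and
    [a >= 1] since [u_j] is a positive integer and [u_(j-1) - c_j + 1 = k_j u_j].
    Everything then follows from
    [x a / (x + a - 1) = 1 + (x - 1) (a - 1) / (x + a - 1)
                       = a - a (a - 1) / (x + a - 1)]. *)

Definition gain (R : realType) (a x : R) : R := x * a / (x + a - 1).

Section Gain.
Context {R : realType}.
Implicit Types a x y : R.

Lemma gainE a x : x + a - 1 != 0 ->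
  gain a x = 1 + (x - 1) * (a - 1) / (x + a - 1).
Proof. by move=> xa_neq0; rewrite /gain; field. Qed.

Lemma gain_ge1 a x : 1 <= a -> 1 <= x -> 1 <= gain a x.
Proof.
move=> a_ge1 x_ge1; have xa_gt0 : 0 < x + a - 1 by lra.
rewrite gainE ?lt0r_neq0// lerDl divr_ge0 ?(ltW xa_gt0)//.
by rewrite mulr_ge0 ?subr_ge0.
Qed.

(** The excess over 1 is a quotient with numerator [(x - 1) * (a - 1)], so it vanishes only with one
    of these factors. *)
Lemma gain_eq1 a x : x + a - 1 != 0 -> gain a x = 1 -> x = 1 \/ a = 1.
Proof.
move=> xa_neq0; rewrite gainE// => /eqP.
rewrite -[eqbRHS]addr0 (inj_eq (addrI 1)) !mulf_eq0 invr_eq0 (negPf xa_neq0) orbF.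
by rewrite !subr_eq0 => /orP[] /eqP; [left|right].
Qed.

(** Here [x] occurs only in the denominator, so monotonicity and the limit in [x] can be read
    off. *)
Lemma gain_limit_sub a x : x + a - 1 != 0 ->
  gain a x = a - a * (a - 1) * (x + a - 1)^-1.
Proof. by move=> xa_neq0; rewrite /gain; field. Qed.

Lemma gain_homo a x y : 1 <= a -> 1 <= x -> x <= y -> gain a x <= gain a y.
Proof.
move=> a_ge1 x_ge1 le_xy.
have xa_gt0 : 0 < x + a - 1 by lra.
have ya_gt0 : 0 < y + a - 1 by lra.
rewrite !gain_limit_sub ?lt0r_neq0// lerD2l lerN2 ler_wpM2l//.
  by rewrite mulr_ge0 ?subr_ge0//; lra.
by rewrite lef_pV2 ?posrE//; lra.
Qed.

Lemma cvg_gain T (F : set_system T) {FF : Filter F} (f : T -> R) a :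
  f t @[t --> F] --> +oo -> gain a (f t) @[t --> F] --> a.
Proof.
move=> f_y.
have fa_gt0 : \forall t \near F, 0 < f t + a - 1.
  by near do rewrite -addrA -ltrBlDr; apply: cvgry_gt.
have inv0 : (f t + a - 1)^-1 @[t --> F] --> (0 : R).
  apply/(gtr0_cvgV0 fa_gt0)/cvgryPge => A.
  near=> t; rewrite -addrA -lerBlDr.
  by near: t; apply: cvgry_ge.
have -> : gain a (f t) @[t --> F] --> a =
          (gain a (f t) @[t --> F] --> a - a * (a - 1) * 0).
  by rewrite mulr0 subr0.
(* The rewritten form needs a nonzero denominator, which holds only eventually along [F]. *)
apply: (@cvg_trans _ (a - a * (a - 1) * (f t + a - 1)^-1 @[t --> F])).
  apply: near_eq_cvg; near=> t.
  by rewrite gain_limit_sub// lt0r_neq0//; near: t.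
by apply: cvgB; [exact: cvg_cst | apply: cvgM; [exact: cvg_cst|]].
Unshelve. all: by end_near. Qed.

End Gain.

Lemma stride_prodS k i : stride_prod k i.+1 = (stride_prod k i * k i.+1)%N.
Proof. by rewrite /stride_prod big_nat_recr. Qed.

Lemma stride_prod_gt0 L k i :
  (forall m, (1 <= m <= L)%N -> (1 <= k m)%N) -> (i <= L)%N ->
  (0 < stride_prod k i)%N.
Proof.
move=> k_gt0 le_iL; rewrite /stride_prod big_nat_cond prodn_cond_gt0// => m.
rewrite andbT ltnS => /andP[m_gt0 le_mi].
by rewrite k_gt0// m_gt0 (leq_trans le_mi).
Qed.

Lemma dvdn_stride_prod k i L : (i <= L)%N -> (stride_prod k i %| stride_prod k L)%N.
Proof.
move=> le_iL; rewrite /stride_prod [X in (_ %| X)%N](@big_cat_nat _ _ _ i.+1)//=.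
by rewrite dvdn_mulr.
Qed.

Section Lengths.
Variables (R : realType) (B L : nat) (c k : nat -> nat).
Hypothesis k_gt0 : forall i, (1 <= i <= L)%N -> (1 <= k i)%N.

Let u := strided_len R B c k.

(** Real division keeps this meaningful for every [D], so it can be compared and sent to infinity
    along all lengths; admissibility enters through the lower bound 1. *)
Definition stride_ratio i D : R := (D%:R - B%:R + 1) / (stride_prod k i)%:R.

(** Subtracting the two recursions cancels [c]: the difference plus 1 is divided by [k i.+1] in each
    layer, starting from [D - B + 1]. *)
Lemma frag_len_sub_strided_len D i : (i <= L)%N ->
  frag_len R D c k i - u i + 1 = stride_ratio i D.
Proof.
elim: i => [_|i IHi lt_iL]; first by rewrite /stride_ratio /stride_prod big_geq// divr1.
have k_neq0 : (k i.+1)%:R != 0 :> R by rewrite pnatr_eq0 -lt0n k_gt0.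
have s_neq0 : (stride_prod k i)%:R != 0 :> R.
  by rewrite pnatr_eq0 -lt0n (stride_prod_gt0 k_gt0)// ltnW.
have {IHi} := IHi (ltnW lt_iL).
rewrite /stride_ratio stride_prodS natrM invfM mulrA => <-.
by rewrite /u /=; field.
Qed.

Lemma speedup_f_gain D j : (1 <= j <= L)%N ->
  speedup_f R B c k j D = gain (u j.-1 - (c j)%:R + 1) (stride_ratio j.-1 D).
Proof.
case: j => // i /= lt_iL.
rewrite /speedup_f /strided_evals_f /sliding_evals_f /gain /=.
have -> : frag_len R D c k i - (c i.+1)%:R + 1 =
    stride_ratio i D + (u i - (c i.+1)%:R + 1) - 1.
  by rewrite -frag_len_sub_strided_len 1?ltnW//; ring.
by rewrite invfM mulrA /stride_ratio -/u; congr (_ / _); rewrite mulrAC.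
Qed.

Lemma speedup_g_gain D j : (1 <= j <= L)%N ->
  speedup_g R B c k j D = gain (u j) (stride_ratio j D).
Proof.
case: j => // i /= lt_iL.
rewrite /speedup_g /strided_evals_g /sliding_evals_g /gain.
(* The block size [k i.+1] joins the stride product, so the ratio has index [i.+1] here, and [i] for
   [f]. *)
rewrite [X in _ / X]mulrA -natrM -stride_prodS.
have -> : frag_len R D c k i.+1 = stride_ratio i.+1 D + u i.+1 - 1.
  by rewrite -frag_len_sub_strided_len//; ring.
by rewrite invfM mulrA {2}/stride_ratio -/u; congr (_ / _); rewrite mulrAC.
Qed.

(** The stride product at [i] divides the one at [L], hence the positive number [D - B + 1], and so
    is at most that number. *)
Lemma stride_ratio_ge1 D i : admissible B L k D -> (i <= L)%N ->
  1 <= stride_ratio i D.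
Proof.
move=> [le_BD dvd_N] le_iL.
rewrite ler_pdivlMr ?ltr0n ?(stride_prod_gt0 k_gt0)// mul1r.
rewrite -natrB// natr1 ler_nat dvdn_leq//.
by rewrite -addn1 (dvdn_trans _ dvd_N) ?dvdn_stride_prod.
Qed.

Lemma stride_ratio_homo i D E : (D <= E)%N -> stride_ratio i D <= stride_ratio i E.
Proof. by move=> le_DE; rewrite ler_wpM2r ?invr_ge0 ?ler0n// !lerD2r ler_nat. Qed.

Lemma cvg_stride_ratio i : (i <= L)%N -> stride_ratio i D @[D --> \oo] --> +oo.
Proof.
move=> le_iL; apply/cvgryPge => A; near=> D.
rewrite ler_pdivlMr ?ltr0n ?(stride_prod_gt0 k_gt0)//.
rewrite -addrA -lerBlDr.
by near: D; exact: nbhs_infty_ger.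
Unshelve. all: by end_near. Qed.

Hypothesis wd : strided_well_defined R B L c k.

Lemma strided_len_ge1 j : (1 <= j <= L)%N -> 1 <= u j.
Proof.
move=> /wd; rewrite -/u => -[/intrP[m ->]].
by rewrite ltr0z ler1z gtz0_ge1.
Qed.

Lemma strided_len_conv_ge1 j : (1 <= j <= L)%N -> 1 <= u j.-1 - (c j)%:R + 1.
Proof.
case: j => // i le_iL /=.
have k_ge1 : 1 <= (k i.+1)%:R :> R by rewrite ler1n k_gt0.
have -> : u i - (c i.+1)%:R + 1 = u i.+1 * (k i.+1)%:R.
  by rewrite /u /= divfK// lt0r_neq0// (lt_le_trans ltr01).
by rewrite -[leLHS]mulr1 ler_pM// strided_len_ge1.
Qed.

End Lengths.

Theorem mainTheorem4 (R : realType) (B L : nat) (c k : nat -> nat)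
    (hB : (1 <= B)%N) (hL : (1 <= L)%N)
    (hc : forall i : nat, (1 <= i <= L)%N -> (1 <= c i)%N)
    (hk : forall i : nat, (1 <= i <= L)%N -> (1 <= k i)%N)
    (hwd : strided_well_defined R B L c k)
    (D : nat) (hD : admissible B L k D)
    (j : nat) (hj : (1 <= j <= L)%N) :
  let u := strided_len R B c k in
  let U := frag_len R D c k in
  let Sf := speedup_f R B c k j in
  let Sg := speedup_g R B c k j in
  let Dk := (D + stride_prod k L)%N in
  (* (1) *)
  ((Sf D = 1 + (U j.-1 - u j.-1) * (u j.-1 - (c j)%:R)
                 / (U j.-1 - (c j)%:R + 1) /\
    1 <= Sf D /\
    (Sf D = 1 -> u j.-1 = U j.-1 \/ u j.-1 = (c j)%:R)) /\
   (Sg D = 1 + (U j - u j) * (u j - 1) / U j /\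
    1 <= Sg D /\
    (Sg D = 1 -> u j = U j \/ u j = 1))) /\
  (* (2) *)
  (Sf D <= Sf Dk /\ Sg D <= Sg Dk) /\
  (* (3) *)
  ((Sf E @[E --> within [set E | admissible B L k E] \oo]
      --> u j.-1 - (c j)%:R + 1) /\
   (Sg E @[E --> within [set E | admissible B L k E] \oo] --> u j)).
Proof.
move=> u U Sf Sg Dk.
have le_jL : (j <= L)%N by case/andP: hj.
have le_j1L : (j.-1 <= L)%N by rewrite (leq_trans (leq_pred j)).
have a_ge1 : 1 <= u j.-1 - (c j)%:R + 1 := strided_len_conv_ge1 hk hwd hj.
have b_ge1 : 1 <= u j := strided_len_ge1 hwd hj.
have x_ge1 : 1 <= stride_ratio R B k j.-1 D := stride_ratio_ge1 R hk hD le_j1L.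
have y_ge1 : 1 <= stride_ratio R B k j D := stride_ratio_ge1 R hk hD le_jL.
have xE := frag_len_sub_strided_len R B c hk D le_j1L.
have yE := frag_len_sub_strided_len R B c hk D le_jL.
rewrite -/u -/U in xE yE.
have SfE E : Sf E = gain (u j.-1 - (c j)%:R + 1) (stride_ratio R B k j.-1 E)
  := speedup_f_gain R B c hk E hj.
have SgE E : Sg E = gain (u j) (stride_ratio R B k j E)
  := speedup_g_gain R B c hk E hj.
have le_DDk : (D <= Dk)%N by rewrite leq_addr.
split; [split | split; split].
- rewrite SfE; split; [|split].
  + rewrite gainE; last by rewrite lt0r_neq0//; lra.
    (* With [x = U j.-1 - u j.-1 + 1] and [a = u j.-1 - c j + 1], the denominator [x + a - 1] is
       [U j.-1 - c j + 1]. *)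
    by rewrite -xE; congr (1 + _ * _ / _); ring.
  + exact: gain_ge1.
  + move=> /gain_eq1[||]; first by rewrite lt0r_neq0//; lra.
    * by rewrite -xE => ?; left; lra.
    * by move=> ?; right; lra.
- rewrite SgE; split; [|split].
  + rewrite gainE; last by rewrite lt0r_neq0//; lra.
    by rewrite -yE; congr (1 + _ * _ / _); ring.
  + exact: gain_ge1.
  + move=> /gain_eq1[||]; first by rewrite lt0r_neq0//; lra.
    * by rewrite -yE => ?; left; lra.
    * by move=> ?; right.
- by rewrite !SfE gain_homo ?stride_ratio_homo.
- by rewrite !SgE gain_homo ?stride_ratio_homo.
(* The limit exists along all lengths, hence along the admissible ones. *)
- rewrite (funext SfE); apply: cvg_within_filter.
  by apply: cvg_gain; exact: (cvg_stride_ratio B hk le_j1L).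
- rewrite (funext SgE); apply: cvg_within_filter.
  by apply: cvg_gain; exact: (cvg_stride_ratio B hk le_jL).
Qed.
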